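(* For all integers $n$, $r$ and $k$ with $n\ge r\ge 1$, $$\sum_{j=r}^n\left\{{n\atop j}\right\}_r c_j^{(k)}=\sum_{\ell=1}^{r}\frac{(-1)^{r-\ell}}{(n-r+\ell+1)^k}\left[{r\atop \ell}\right].$$
   Context: For an integer $k$, the poly-Cauchy numbers (of the first kind) $c_n^{(k)}$ are defined by $\mathrm{Lif}_k(\log(1+x))=\sum_{n\ge0}c_n^{(k)}x^n/n!$, where $\mathrm{Lif}_k(z)=\sum_{m\ge0}\frac{z^m}{m!(m+1)^k}$. $\left[{n\atop m}\right]$ denotes the unsigned Stirling number of the first kind, defined by $x(x+1)\cdots(x+n-1)=\sum_{m}\left[{n\atop m}\right]x^m$. For $r\ge 0$, the $r$-Stirling number of the second kind $\left\{{n\atop m}\right\}_r$ is the number of ways to partition $\{1,\dots,n\}$ into $m$ nonempty disjoint blocks such that $1,\dots,r$ lie in distinct blocks; equivalently $\left\{{n\atop m}\right\}_r=0$ for $n<r$, $\left\{{r\atop m}\right\}_r=\delta_{m,r}$, and $\left\{{n\atop m}\right\}_r=m\left\{{n-1\atop m}\right\}_r+\left\{{n-1\atop m-1}\right\}_r$ for $n>r$. *)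

(* Defs.v *)
From HB Require Import structures.
From mathcomp Require Import all_boot all_order all_algebra.
Set Implicit Arguments.
Unset Strict Implicit.
Unset Printing Implicit Defensive.
Import Order.TTheory GRing.Theory Num.Theory.
Local Open Scope ring_scope.

(* A function f : nat -> rat stands for the formal power series
   sum_(i >= 0) f i x^i. *)
Definition fps_one : nat -> rat := fun n => (n == 0%N)%:R.

Definition fps_mul (f g : nat -> rat) : nat -> rat :=
  fun n => \sum_(i < n.+1) f i * g (n - i)%N.

Definition fps_exp (g : nat -> rat) (m : nat) : nat -> rat :=
  iter m (fps_mul g) fps_one.

(* The series sum_(m >= 0) f m g^m; to be used only when g 0 = 0, in which case
   g^m has no term of degree less than m, so that the terms m > n do not
   contribute to the coefficient of x^n (see fps_exp_low). *)
Definition fps_comp (f g : nat -> rat) : nat -> rat :=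
  fun n => \sum_(m < n.+1) f m * fps_exp g m n.

Lemma fps_exp_low (g : nat -> rat) (m n : nat) :
  g 0%N = 0 -> (n < m)%N -> fps_exp g m n = 0.
Proof.
move=> g0; elim: m n => // m IHm n lt_nm; rewrite /fps_exp iterS /fps_mul.
apply: big1 => -[[|i] /= lt_in] _; first by rewrite g0 mul0r.
rewrite -/(fps_exp g m) IHm ?mulr0 // ltn_subLR //.
by rewrite (leq_trans lt_nm) // addSn ltnS leq_addl.
Qed.

Definition Lif (k : int) : nat -> rat :=
  fun m => (m`!%:R * m.+1%:R ^ k)^-1.

(* log(1+x) = sum_(n >= 1) (-1)^(n-1) x^n / n *)
Definition log1p : nat -> rat :=
  fun n => if n is n'.+1 then (-1) ^+ n' / n'.+1%:R else 0.

(* c_n^(k) is n! times the coefficient of x^n in Lif_k(log(1+x)). *)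
Definition poly_cauchy (k : int) (n : nat) : rat :=
  n`!%:R * fps_comp (Lif k) log1p n.

(* The polynomial x(x+1)...(x+n-1) has its coefficients in the semiring nat. *)
Definition stirling1 (n m : nat) : nat :=
  ((\prod_(i < n) ('X + i%:R%:P))`_m)%R.

(* The set {1, ..., n} is represented by 'I_n, so that 1, ..., r become the
   ordinals i < r. These are all available only if r <= n; otherwise the
   number is 0. *)
Definition rstirling2 (r n m : nat) : nat :=
  #|[set P : {set {set 'I_n}} |
      [&& (r <= n)%N, partition P [set: 'I_n], #|P| == m &
          [forall i : 'I_n, forall j : 'I_n,
             [&& (i < r)%N, (j < r)%N & i != j] ==>
               (pblock P i != pblock P j)]]]|.

(* Main.v *)
(* Let ff j = X(X-1)...(X-j+1).  Since the coefficients of ff j count, up to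
   j!/m!, those of log(1+x)^m, the number c_j^(k) is the image of ff j under the
   linear functional X^m |-> (m+1)^-k.  It thus suffices to prove
   sum_j S_r(n, j) ff j = X^(n-r) ff r, S_r being the r-Stirling numbers.  At a
   natural number y both sides count the maps from {1, ..., n} to {1, ..., y}
   that are injective on {1, ..., r}, grouped by kernel on the left. *)
Require Import Defs.
From mathcomp Require Import all_boot all_order all_algebra.
From mathcomp Require Import ring.
Import Order.TTheory GRing.Theory Num.Theory.
Local Open Scope ring_scope.

(** * Maps with a prescribed kernel *)

Section KernelCount.
Variables T U : finType.
Implicit Types (f : {ffun T -> U}) (P : {set {set T}}).

Definition kernel f : {set {set T}} := preim_partition f [set: T].

Lemma kernel_partition f : partition (kernel f) [set: T].
Proof. exact: preim_partitionP. Qed.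

Lemma eq_pblock_kernel f x y :
  (pblock (kernel f) x == pblock (kernel f) y) = (f x == f y).
Proof.
have tr : trivIset (kernel f) by case/and3P: (kernel_partition f).
rewrite eq_pblock ?(cover_partition (kernel_partition f)) ?inE //.
by rewrite pblock_equivalence_partition ?inE // => a b c _ _ _; split=> // /eqP->.
Qed.

(** Each block is the [pblock] of any of its points, so the relation of lying in a common block
    determines it. *)
Lemma eq_partition P Q :
    partition P [set: T] -> partition Q [set: T] ->
    (forall x y, (pblock P x == pblock P y) = (pblock Q x == pblock Q y)) ->
  P = Q.
Proof.
suff sub P' Q' : partition P' [set: T] -> partition Q' [set: T] ->
    (forall x y, (pblock P' x == pblock P' y) = (pblock Q' x == pblock Q' y)) ->
    P' \subset Q'.
  move=> pP pQ e; apply/eqP; rewrite eqEsubset !sub // => x y; exact/esym/e.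
move=> pP pQ e; apply/subsetP => B BP.
have trP : trivIset P' by case/and3P: pP.
have trQ : trivIset Q' by case/and3P: pQ.
have [x xB] : exists x, x \in B.
  apply/set0Pn; apply: contraL BP => /eqP->; by case/and3P: pP.
suff -> : B = pblock Q' x.
  by apply: pblock_mem; rewrite (cover_partition pQ) inE.
apply/setP => y; rewrite -(def_pblock trP BP xB).
rewrite -!eq_pblock ?(cover_partition pP) ?(cover_partition pQ) ?inE //.
Qed.

(** A map with kernel [P] factors uniquely as the quotient map [bl] followed by an injection of the
    set of blocks into [U]; [h] is composition with [bl]. *)
Lemma card_kernel P : partition P [set: T] ->
  #|[set f | kernel f == P]| = #|U| ^_ #|P|.
Proof.
move=> pP; pose S := {B : {set T} | B \in P}.
have cS : #|{: S}| = #|P| by rewrite card_sig; apply: eq_card => B; rewrite inE.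
have bP x : pblock P x \in P.
  by apply: pblock_mem; rewrite (cover_partition pP) inE.
pose bl x : S := exist _ (pblock P x) (bP x).
have trP : trivIset P by case/and3P: pP.
have blsurj (s : S) : exists x, bl x == s.
  case: s => B BP.
  have [x xB] : exists x, x \in B.
    apply/set0Pn; apply: contraTneq BP => ->; by case/and3P: pP.
  by exists x; rewrite -val_eqE /= (def_pblock trP BP xB).
pose h (g : {ffun S -> U}) : {ffun T -> U} := [ffun x => g (bl x)].
have hinj : injective h.
  move=> g1 g2 /ffunP e; apply/ffunP => s; have [x /eqP <-] := blsurj s.
  by have := e x; rewrite !ffunE.
rewrite -cS -card_inj_ffuns -(card_imset _ hinj).
apply: eq_card => f; rewrite inE; apply/eqP/imsetP => [kf | [g]].
(* The value of [f] at a chosen point of the block; by [fE] the choice of point is immaterial. *)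
- pose g : {ffun S -> U} := [ffun s => f (xchoose (blsurj s))].
  have fE x y : (f x == f y) = (bl x == bl y).
    by rewrite -eq_pblock_kernel kf -val_eqE.
  exists g; last first.
    apply/ffunP => x; rewrite !ffunE; apply/eqP; rewrite fE.
    by rewrite eq_sym (xchooseP (blsurj (bl x))).
  rewrite inE; apply/injectiveP => s1 s2; rewrite !ffunE => /eqP.
  by rewrite fE !(eqP (xchooseP (blsurj _))) => /eqP.
- rewrite inE => /injectiveP ginj ->.
  apply: eq_partition => // [|x y]; first exact: kernel_partition.
  by rewrite eq_pblock_kernel !ffunE (inj_eq ginj) -val_eqE.
Qed.

End KernelCount.

(** * Maps injective on the first [r] points, and the counting identity *)

Definition inj_below (U : finType) (n r : nat) (f : {ffun 'I_n -> U}) : bool :=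
  [forall i : 'I_n, forall j : 'I_n,
     [&& (i < r)%N, (j < r)%N & i != j] ==> (f i != f j)].

(** Such a map is an injection on the first [r] points glued by [h] to an arbitrary map on the last
    [m]. *)
Lemma card_inj_below (U : finType) (r m : nat) :
  #|[set f : {ffun 'I_(r + m) -> U} | inj_below U (r + m) r f]|
    = (#|U| ^_ r * #|U| ^ m)%N.
Proof.
pose h (p : {ffun 'I_r -> U} * {ffun 'I_m -> U}) : {ffun 'I_(r + m) -> U} :=
  [ffun i => match split i with inl a => p.1 a | inr b => p.2 b end].
have hl p a : h p (lshift m a) = p.1 a.
  by rewrite ffunE (unsplitK (inl a)).
have hr p b : h p (rshift r b) = p.2 b.
  by rewrite ffunE (unsplitK (inr b)).
have hinj : injective h.
  move=> [p1 p2] [q1 q2] /ffunP e; congr pair; apply/ffunP => a.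
    by have := e (lshift m a); rewrite !hl.
  by have := e (rshift r a); rewrite !hr.
have -> : (#|U| ^_ r * #|U| ^ m)%N =
   #|setX [set f : {ffun 'I_r -> U} | injectiveb f] [set: {ffun 'I_m -> U}]|.
  by rewrite cardsX card_inj_ffuns cardsT card_ffun !card_ord.
rewrite -(card_imset _ hinj); apply: eq_card => f; rewrite inE.
apply/forallP/imsetP => [fi | [[g1 g2]]].
- exists ([ffun a => f (lshift m a)], [ffun b => f (rshift r b)]).
    rewrite !inE andbT; apply/injectiveP => a b; rewrite !ffunE => /eqP.
    have /forallP /(_ (lshift m b)) := fi (lshift m a).
    rewrite /= !ltn_ord /= => H E; apply/eqP; apply: contraTT E => ab.
    apply: (implyP H); apply: contraNneq ab => /(@lshift_inj _ _ _ _) ->; exact: eqxx.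
  by apply/ffunP => i; rewrite -[i]splitK; case: (split i) => a;
     rewrite /= ?hl ?hr ffunE.
- rewrite !inE andbT => /injectiveP gi -> i; apply/forallP => j.
  apply/implyP => /and3P [ir jr ij].
  have -> : i = lshift m (Ordinal ir) by apply: val_inj.
  have -> : j = lshift m (Ordinal jr) by apply: val_inj.
  by rewrite !hl (inj_eq gi); apply: contra ij => /eqP [/val_inj ->].
Qed.

Lemma sum_rstirling2_ffact (n r y : nat) : (r <= n)%N ->
  (\sum_(j < n.+1) rstirling2 r n j * y ^_ j = y ^_ r * y ^ (n - r))%N.
Proof.
move=> le_rn.
have := card_inj_below 'I_y r (n - r); rewrite subnKC // card_ord => <-.
pose A (P : {set {set 'I_n}}) := [&& partition P [set: 'I_n] &
  [forall i : 'I_n, forall j : 'I_n,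
     [&& (i < r)%N, (j < r)%N & i != j] ==> (pblock P i != pblock P j)]].
have kA (f : {ffun 'I_n -> 'I_y}) : inj_below 'I_y n r f = A (kernel _ _ f).
  rewrite /A kernel_partition; apply: eq_forallb => i; apply: eq_forallb => j.
  by rewrite eq_pblock_kernel.
have cardP (P : {set {set 'I_n}}) : A P -> (#|P| < n.+1)%N.
  move=> /andP[pP _]; rewrite ltnS.
  have /and3P [_ tr n0] := pP.
  rewrite -[leqRHS]card_ord -cardsT (card_partition pP) -sum1_card.
  apply: leq_sum => B BP; rewrite card_gt0; apply: contraTneq BP => -> //.
rewrite -sum1_card (partition_big (fun f => kernel _ _ f) A) /=; last first.
  by move=> f; rewrite inE kA.
transitivity (\sum_(P | A P) y ^_ #|P|)%N; last first.
  apply: eq_bigr => P AP; have /andP[pP _] := AP.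
  rewrite -[X in (X ^_ _)%N]card_ord -(card_kernel _ _ P pP) -sum1_card.
  apply: eq_bigl => f; rewrite !inE kA.
  by case: eqP => [->|]; rewrite ?AP ?andbF.
(* Partitions are grouped by number of blocks; by [cardP] this is at most [n], so [inord] never
   falls back on its default value. *)
rewrite (partition_big (fun P : {set {set 'I_n}} => inord #|P| : 'I_n.+1) xpredT) //=.
apply: eq_bigr => j _; rewrite /rstirling2 -sum1_card big_distrl /=.
apply: eq_big => [P|P].
  rewrite inE le_rn /=.
  have [AP|nAP] := boolP (A P).
    have /andP[-> ->] := AP.
    by rewrite andbT -val_eqE /= inordK ?cardP.
  apply: contraNF nAP => /and3P [p1 _ p2]; exact/andP.
by rewrite inE mul1n => /and4P [_ _ /eqP -> _].
Qed.

(** * Falling factorials as polynomials *)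

Definition falling (n : nat) : {poly rat} := \prod_(i < n) ('X - i%:R%:P).

Lemma fallingS n : falling n.+1 = falling n * ('X - n%:R%:P).
Proof. exact: big_ord_recr. Qed.

Lemma falling_nat (n y : nat) : (falling n).[y%:R] = (y ^_ n)%:R.
Proof.
elim: n => [|n IH]; first by rewrite /falling big_ord0 hornerC.
rewrite fallingS hornerM IH !hornerE ffactnSr natrM.
have [lt_yn|le_ny] := ltnP y n; last by rewrite natrB.
by rewrite ffact_small // !mul0r.
Qed.

Lemma size_falling n : size (falling n) = n.+1.
Proof. by rewrite /falling -big_enum size_prod_XsubC size_enum_ord. Qed.

Lemma coef_falling0 m : (falling 0)`_m = (m == 0%N)%:R.
Proof. by rewrite /falling big_ord0 coef1. Qed.

Lemma coef0_fallingS n : (falling n.+1)`_0 = - n%:R * (falling n)`_0.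
Proof. by rewrite fallingS mulrBr coefB coefMX coefMC sub0r mulNr mulrC. Qed.

Lemma coefS_fallingS n m :
  (falling n.+1)`_m.+1 = (falling n)`_m - n%:R * (falling n)`_m.+1.
Proof. by rewrite fallingS mulrBr coefB coefMX coefMC /= mulrC. Qed.

(** If nonzero, [p - q] would have the distinct roots 0, 1, ..., [size (p - q)] - 1, which is one
    more than its degree allows. *)
Lemma poly_eq_on_nat (R : numDomainType) (p q : {poly R}) :
  (forall y : nat, p.[y%:R] = q.[y%:R]) -> p = q.
Proof.
move=> e; apply/eqP; rewrite -subr_eq0; apply/negPn/negP => nz.
pose s : seq R := [seq y%:R | y <- iota 0 (size (p - q))].
have := @max_poly_roots R (p - q) s nz.
rewrite size_map size_iota ltnn => H; apply/notF/H.
  by apply/allP => _ /mapP [y _ ->]; rewrite rootE hornerD hornerN e subrr.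
rewrite map_inj_uniq ?iota_uniq // => a b /eqP; by rewrite eqr_nat => /eqP.
Qed.

Lemma sum_rstirling2_falling (n r : nat) : (r <= n)%N ->
  \sum_(j < n.+1) (rstirling2 r n j)%:R *: falling j = falling r * 'X^(n - r).
Proof.
move=> le_rn; apply: poly_eq_on_nat => y.
rewrite horner_sum hornerM hornerXn falling_nat -natrX -natrM.
rewrite -sum_rstirling2_ffact // natr_sum; apply: eq_bigr => j _.
by rewrite hornerZ falling_nat natrM.
Qed.

(** * Stirling numbers of the first kind as coefficients *)

Lemma stirling10 m : stirling1 0 m = (m == 0%N).
Proof. by rewrite /stirling1 big_ord0 coef1; case: eqP. Qed.

Lemma stirling1S0 n : stirling1 n.+1 0 = (n * stirling1 n 0)%N.
Proof.
by rewrite /stirling1 big_ord_recr /= mulrDr coefD coefMX coefMC /= add0r mulrC natn.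
Qed.

Lemma stirling1SS n m :
  stirling1 n.+1 m.+1 = (stirling1 n m + n * stirling1 n m.+1)%N.
Proof.
by rewrite /stirling1 big_ord_recr /= mulrDr coefD coefMX coefMC /= natn [(_ * n)%R]mulrC.
Qed.

(** The two recurrences agree up to sign. The exponent [n + m] has the parity of the usual n - m and
    avoids truncated subtraction. *)
Lemma coef_falling n m : (falling n)`_m = (-1) ^+ (n + m) * (stirling1 n m)%:R.
Proof.
elim: n m => [|n IH] [|m].
- by rewrite coef_falling0 stirling10 mul1r.
- by rewrite coef_falling0 stirling10 mulr0.
- by rewrite coef0_fallingS IH stirling1S0 natrM !addn0 exprS; ring.
by rewrite coefS_fallingS !IH stirling1SS natrD natrM addSn !addnS !exprS; ring.
Qed.

(** * Powers of log(1+x) *)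

Lemma fps_exp_poly (N : nat) (g : nat -> rat) (m n : nat) : (n <= N)%N ->
  fps_exp g m n = ((\poly_(i < N.+1) g i) ^+ m)`_n.
Proof.
elim: m n => [|m IH] n le_nN; first by rewrite expr0 coef1.
rewrite /fps_exp iterS -/(fps_exp g m) exprS coefM; apply: eq_bigr => i _.
rewrite coef_poly ltnS IH; last exact: leq_trans (leq_subr _ _) le_nN.
by rewrite (leq_trans _ le_nN) // -ltnS.
Qed.

(* Coefficient of x^j in (1 + x) (L^(m+1))' = (m + 1) L^m, for
   L = log(1+x). *)
Lemma fps_exp_log1pS (m j : nat) :
  j.+1%:R * fps_exp log1p m.+1 j.+1 + j%:R * fps_exp log1p m.+1 j
    = m.+1%:R * fps_exp log1p m j.
Proof.
(* Truncating the logarithm at degree j+1 keeps all coefficients involved and gives access to the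
   derivative of polynomials. *)
rewrite !(fps_exp_poly j.+1) //.
set p := \poly_(i < _) _.
have dp : (1 + 'X) * p^`() = 1 - (- 'X) ^+ j.+1 :> {poly rat}.
  have -> : p^`() = \sum_(i < j.+1) (- 'X) ^+ i.
    apply/polyP => i; rewrite coef_deriv coef_poly coef_sum ltnS.
    under eq_bigr => l _ do rewrite exprNn -[(-1) ^+ l]mulr1 -polyC1 -polyCN
      -polyC_exp mulr1 coefCM coefXn.
    have [lt_ij|le_ji] := ltnP i j.+1.
      rewrite (bigD1 (Ordinal lt_ij)) //= eqxx mulr1 big1 ?addr0.
        by rewrite -[LHS]mulr_natr divfK // pnatr_eq0.
      move=> l; rewrite -val_eqE /= eq_sym => /negPf ->; exact: mulr0.
    rewrite mul0rn big1 // => l _.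
    by rewrite [i == l]gtn_eqF ?mulr0 // (leq_trans (ltn_ord l)).
  rewrite -[RHS]opprB subrX1 -mulNr opprB opprK.
  by congr (_ * _).
have E : (1 + 'X) * (p ^+ m.+1)^`() = (p ^+ m *+ m.+1) * (1 - (- 'X) ^+ j.+1).
  by rewrite -dp deriv_exp /=; ring.
have := congr1 (fun q : {poly rat} => q`_j) E.
rewrite mulrDl mul1r coefD coefXM coef_deriv mulrBr mulr1 coefB.
rewrite exprNn mulrA coefMXn ltnSn subr0 coefMn !mulr_natl => <-.
congr (_ + _); case: (j) => [|i] /=; first by rewrite mulr0n.
by rewrite coef_deriv.
Qed.

(** Both sides satisfy a(j+1, m+1) = (m+1) a(j, m) - j a(j, m+1): the left one by [fps_exp_log1pS],
    the right one by [coefS_fallingS]. *)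
Lemma fps_exp_log1p (m j : nat) :
  j`!%:R * fps_exp log1p m j = m`!%:R * (falling j)`_m.
Proof.
elim: j m => [|j IH] [|m].
- by rewrite coef_falling0.
- by rewrite fps_exp_low // coef_falling0 !mulr0.
- have := IH 0%N; rewrite coef0_fallingS /fps_exp /= /fps_one mulr0 mul1r.
  case: j {IH} => [|j] /=; first by rewrite mul0r mulr0.
  by rewrite mulr0 mul1r => <-; rewrite mulr0.
rewrite coefS_fallingS mulrBr.
have -> : m.+1`!%:R * (falling j)`_m = m.+1%:R * (j`!%:R * fps_exp log1p m j).
  by rewrite IH factS natrM mulrA.
by rewrite [X in _ - X]mulrCA -IH [_ * (_ * fps_exp _ m _)]mulrCA -fps_exp_log1pS
  factS natrM; ring.
Qed.

(** * Poly-Cauchy numbers and the final summation *)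

Lemma poly_cauchyE (k : int) (n : nat) :
  poly_cauchy k n = \sum_(m < n.+1) (falling n)`_m / m.+1%:R ^ k.
Proof.
rewrite /poly_cauchy /fps_comp mulr_sumr; apply: eq_bigr => m _.
rewrite mulrCA fps_exp_log1p /Lif invfM mulrACA.
by rewrite mulVf ?pnatr_eq0 -?lt0n ?fact_gt0 // mul1r mulrC.
Qed.

(* Take y = j in the counting identity: its right-hand side vanishes. *)
Lemma rstirling2_small (r n j : nat) : (j < r)%N -> rstirling2 r n j = 0%N.
Proof.
move=> lt_jr; have [lt_nr|le_rn] := ltnP n r.
  apply: eq_card0 => P; by rewrite inE leqNgt lt_nr.
have lt_jn : (j < n.+1)%N by rewrite ltnS (leq_trans (ltnW lt_jr)).
have /eqP := sum_rstirling2_ffact n r j le_rn.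
rewrite (ffact_small lt_jr) mul0n sum_nat_eq0 => /forallP /(_ (Ordinal lt_jn)) /=.
by rewrite muln_eq0 [_ ^_ _ == _]eqn0Ngt ffact_gt0 leqnn orbF => /eqP.
Qed.

Theorem theorem1 (n r : nat) (k : int) (hr : (1 <= r)%N) (hrn : (r <= n)%N) :
  \sum_(r <= j < n.+1) (rstirling2 r n j)%:R * poly_cauchy k j =
  \sum_(1 <= l < r.+1)
     (-1) ^+ (r - l) / ((n - r + l + 1)%N%:R ^ k) * (stirling1 r l)%:R :> rat.
Proof.
(* A range of [m] common to all [j] allows the sums to be exchanged; the added coefficients lie
   above the degree of [falling j]. *)
have cE j : (j <= n)%N ->
    poly_cauchy k j = \sum_(m < n.+1) (falling j)`_m / m.+1%:R ^ k.
  move=> le_jn; rewrite poly_cauchyE.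
  rewrite (big_ord_widen n.+1 (fun m => (falling j)`_m / m.+1%:R ^ k)) //.
  rewrite big_mkcond; apply: eq_bigr => m _; case: ltnP => // lt_jm.
  by rewrite nth_default ?size_falling // mul0r.
transitivity (\sum_(j < n.+1) (rstirling2 r n j)%:R * poly_cauchy k j).
  rewrite -(big_mkord xpredT (fun j => (rstirling2 r n j)%:R * poly_cauchy k j)).
  rewrite [RHS](big_cat_nat (n := r)) //=; last exact: leqW.
  rewrite [X in _ = X + _]big_nat_cond [X in _ = X + _]big1 ?add0r //.
  move=> j /andP[/andP[_ lt_jr] _].
  by rewrite rstirling2_small // mul0r.
(* The functional X^m |-> (m+1)^-k is applied to [sum_rstirling2_falling]. *)
transitivity (\sum_(m < n.+1) (falling r * 'X^(n - r))`_m / m.+1%:R ^ k).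
  under eq_bigr => j _ do rewrite (cE j (ltn_ord j)) mulr_sumr.
  rewrite exchange_big /=; apply: eq_bigr => m _.
  rewrite -sum_rstirling2_falling // coef_sum mulr_suml; apply: eq_bigr => j _.
  by rewrite coefZ mulrA.
rewrite -(big_mkord xpredT (fun m => (falling r * 'X^(n - r))`_m / m.+1%:R ^ k)).
(* The factor X^(n-r) kills the terms with m < n - r; the others are reindexed by m = n - r + l. *)
rewrite (big_cat_nat (n := n - r)) //=; last by rewrite leqW ?leq_subr.
rewrite big_nat_cond big1 ?add0r => [|m /andP[/andP[_ lt_m] _]]; last first.
  by rewrite coefMXn lt_m mul0r.
rewrite -{1}[(n - r)%N]add0n big_addn subSn ?leq_subr // subKn //.
rewrite big_nat_recl // coefMXn ltnn subnn.
(* Since r >= 1, 0 is a root of [falling r], so the sum starts at l = 1. *)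
have -> : (falling r)`_0 = 0.
  by rewrite -horner_coef0 (falling_nat r 0) ffact_small.
rewrite mul0r add0r [RHS]big_add1 /=.
apply: eq_big_nat => l /andP[_ lt_lr].
rewrite coefMXn ltnNge leq_addl addnK coef_falling /= addn1 [(n - r + _)%N]addnC.
(* For l <= r, the exponents r + l and r - l have the same parity. *)
by rewrite -signr_odd oddD -oddB // signr_odd mulrAC.
Qed.
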